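(* Consider a stable FIFO single-server discrete-time queue with service-time-independent discipline (so that $ESW^q=ES\cdot EW^q$), and assume ASTA holds for the workload, i.e. the customer average $EV^A$ of the workload found by arrivals equals the time-average workload $EV$. Then $$EW^q=\frac{\lambda(ES^2-ES)}{2(1-\rho)},$$ where $\rho=\lambda ES<1$.
   Context: Sample-path setting, actual system (arrivals and departures at integer times). Customer $k\ge1$ arrives at the integer $A_k$ ($0\le A_k\le A_{k+1}$, $A_k\to\infty$), has integer work requirement $S_k\ge1$, waits $W^q_k\ge0$ (an integer) in the queue before starting service, and is then served without interruption at unit rate, so departs at $A_k+W^q_k+S_k$; the single server is never idle when customers are waiting and serves in order of arrival. Let $\lambda=\lim_{\tau\to\infty}\tau^{-1}\#\{k:A_k\le\tau\}$, and assume the following limits exist and are finite: $\lambda$, $$ES=\lim_n\frac1n\sum_{k=1}^nS_k,\quad ES^2=\lim_n\frac1n\sum_{k=1}^nS_k^2,\quad EW^q=\lim_n\frac1n\sum_{k=1}^nW^q_k,\quad ESW^q=\lim_n\frac1n\sum_{k=1}^nS_kW^q_k$$ (here $ES^2$ denotes the second moment, not $(ES)^2$). The work remaining for customer $k$ at time $\tau$ is $$f_k(\tau)=S_k\mathbf 1\{A_k<\tau\le A_k+W^q_k\}+(S_k-(\tau-A_k-W^q_k))\mathbf 1\{A_k+W^q_k<\tau\le A_k+W^q_k+S_k\},$$ $V(\tau)=\sum_{k=1}^\infty f_k(\tau)$ is the total work in the system at time $\tau$, and $EV=\lim_{\tau\to\infty}\tau^{-1}\sum_{j=1}^\tau V(j)$.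 $EV^A=\lim_{n\to\infty}n^{-1}\sum_{k=1}^nV^A_k$, where $V^A_k$ is the work in the system found by customer $k$ on arrival (including the work of customers ahead of it in the same arrival batch, if any; for single arrivals $V^A_k=V(A_k)$). *)

(* Defs.v *)
From HB Require Import structures.
From mathcomp Require Import all_boot all_order all_algebra.
From mathcomp Require Import finmap.
From mathcomp Require Import all_classical all_reals all_analysis.

Set Implicit Arguments.
Unset Strict Implicit.
Unset Printing Implicit Defensive.

Import Order.TTheory GRing.Theory Num.Theory.
Import numFieldNormedType.Exports.

Local Open Scope classical_set_scope.
Local Open Scope ring_scope.

(* Customers are numbered from 0: customer number k of the usual 1-based
   numbering has index k.-1 here.  A, S, Wq are the arrival times, the service
   requirements and the waiting times in queue; customer k is in service
   exactly during the time slots [t, t + 1) with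
   A k + Wq k <= t < A k + Wq k + S k. *)

Record fifo_queue (A S Wq : nat -> nat) : Prop := FifoQueue {
  arrivals_ordered : forall k, (A k <= A k.+1)%N;
  arrivals_diverge : A k @[k --> \oo] --> \oo;
  service_ge1 : forall k, (1 <= S k)%N;
  (* single server, service in order of arrival *)
  served_in_order : forall k, (A k + Wq k + S k <= A k.+1 + Wq k.+1)%N;
  (* whenever some customer waits, some customer is being served *)
  never_idle_when_waiting : forall k t, (A k <= t < A k + Wq k)%N ->
    exists j, (A j + Wq j <= t < A j + Wq j + S j)%N
}.

(* #{k : A k <= t} / t; the set is finite because A diverges. *)
Definition arrival_frequency (R : realType) (A : nat -> nat) (t : nat) : R :=
  (#|` fset_set [set k | (A k <= t)%N]|)%fset%:R / t%:R.

Definition remaining_work (R : realType) (A S Wq : nat -> nat) (k t : nat) : R :=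
  (S k)%:R * (A k < t <= A k + Wq k)%N%:R +
  ((S k)%:R - (t%:R - (A k)%:R - (Wq k)%:R)) *
    (A k + Wq k < t <= A k + Wq k + S k)%N%:R.

(* Only finitely many terms are nonzero, since A diverges. *)
Definition workload (R : realType) (A S Wq : nat -> nat) (t : nat) : R :=
  limn (series (fun k => remaining_work R A S Wq k t)).

(* Work found on arrival: [workload] at A k ignores the customers arriving at
   A k, so those ahead of k in its own batch are added. *)
Definition workload_at_arrival (R : realType) (A S Wq : nat -> nat) (k : nat)
    : R :=
  workload R A S Wq (A k) + \sum_(j < k | A j == A k) (S j)%:R.

(* [arithmetic_mean u n] averages u 0, ..., u n, so the shift makes this the
   limit of (V 1 + ... + V t) / t. *)
Definition time_average_workload (R : realType) (A S Wq : nat -> nat) : R :=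
  limn (arithmetic_mean (fun j => workload R A S Wq j.+1)).

Definition customer_average_workload (R : realType) (A S Wq : nat -> nat) : R :=
  limn (arithmetic_mean (workload_at_arrival R A S Wq)).

(* Arrivals see time averages, for the workload.  Both limits exist as soon as
   the averages of S, S^2, Wq and S * Wq and the arrival rate converge. *)
Definition workload_ASTA (R : realType) (A S Wq : nat -> nat) : Prop :=
  customer_average_workload R A S Wq = time_average_workload R A S Wq.

(* Main.v *)
Require Import Defs.
From mathcomp Require Import all_boot all_order all_algebra.
From mathcomp Require Import finmap.
From mathcomp Require Import all_classical all_reals all_analysis.
From mathcomp Require Import zify ring lra.

Set Implicit Arguments.
Unset Strict Implicit.

Import Order.TTheory GRing.Theory Num.Theory.
Import numFieldNormedType.Exports.

Local Open Scope classical_set_scope.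
Local Open Scope ring_scope.

(** The formula is one linear equation for EWq: the mean workload is computed
    twice, once seen by customers and once seen by the clock, and ASTA equates
    the two values.

    Seen by customers: the server works at unit rate and in order of arrival
    without idling while somebody waits, so the work found by customer [k] is
    exactly its waiting time [Wq k] ([workload_at_arrivalE]).  This rests on
    Lindley's recursion ([Lindley]) and on the fact that, after the arrival of
    customer [k], the work left over from customers [0..k] is the time until
    [k] departs ([sum_residual_work]).  Hence the customer average of the
    workload is EWq.

    Seen by the clock: over its whole stay, customer [k] contributes
    S Wq + S (S - 1) / 2 to the sum of the workload over integer times, namely
    S during each of the Wq slots of waiting and then S - 1, S - 2, ..., 0 in
    service ([sum_remaining_work]).  By the usual argument behind H = lambda G
    ([cvg_time_average_workload]), the time average of the workload is lambda
    times the customer average of these contributions, which is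
    lambda (ESWq + (ES2 - ES) / 2).  The argument is a sandwich: up to time [T]
    the accumulated workload is at most the total contribution of the
    customers who arrived by [T], and at least that of the customers who
    arrived by [T - c], where [c] is the longest sojourn among the arrivals by
    [T], because these have all left by [T].  Since a sequence with convergent
    averages has terms of order o(n), and so has its running maximum, [c] is
    o(T) and both bounds have the same limit.

    With ESWq = ES EWq the equality of both averages reads
    EWq = rho EWq + lambda (ES2 - ES) / 2. *)

(** * Sample-path dynamics of the queue *)

Definition departure (A S Wq : nat -> nat) (k : nat) : nat :=
  (A k + Wq k + S k)%N.

(** Once the customer has arrived, its remaining work is its service time capped
    by the time left until its departure; truncated subtraction makes it vanish
    after the departure. *)
Definition remaining_work_nat (A S Wq : nat -> nat) (k t : nat) : nat :=
  if (A k < t)%N then minn (S k) (departure A S Wq k - t) else 0%N.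

Lemma remaining_workE (R : realType) A S Wq k t :
  remaining_work R A S Wq k t = (remaining_work_nat A S Wq k t)%:R.
Proof.
rewrite /remaining_work /remaining_work_nat /departure.
have [ltAt|leAt] := ltnP (A k) t; last first.
  have -> : (A k + Wq k < t <= A k + Wq k + S k)%N = false by lia.
  by rewrite /= !mulr0 addr0.
have [leWt|ltWt] := leqP t (A k + Wq k).
  by rewrite /= mulr0 mulr1 addr0 (minn_idPl _)//; lia.
rewrite /= mulr0 add0r; have [leDt|ltDt] := leqP t (A k + Wq k + S k).
  rewrite mulr1 (minn_idPr _); last by lia.
  by rewrite natrB // !natrD; ring.
by rewrite mulr0 (_ : minn _ _ = 0%N) //; lia.
Qed.

Lemma arrivals_nondecreasing A S Wq : fifo_queue A S Wq ->
  {homo A : i j / (i <= j)%N}.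
Proof. by move=> q; apply: homo_leq => //; [exact: leq_trans | case: q]. Qed.

Lemma departures_nondecreasing A S Wq : fifo_queue A S Wq ->
  {homo departure A S Wq : i j / (i <= j)%N}.
Proof.
move=> q; apply: homo_leq => //; first exact: leq_trans.
by move=> k; have := served_in_order q k; rewrite /departure; lia.
Qed.

(** In the last slot of the wait of [k] the server is busy, by the no-idling
    rule, and it is busy with an earlier customer, since service is in order;
    that customer leaves no sooner than the start of service of [k]. *)
Lemma waiting_served_by_earlier A S Wq k : fifo_queue A S Wq ->
  (0 < Wq k)%N -> exists2 j, (j < k)%N & (A k + Wq k <= departure A S Wq j)%N.
Proof.
move=> q W0.
have [|j] := @never_idle_when_waiting _ _ _ q k (A k + Wq k).-1; first by lia.
move=> hj; exists j; last by rewrite /departure; lia.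
rewrite ltnNge; apply/negP => lekj.
have : (A k + Wq k <= A j + Wq j)%N.
  apply: (@homo_leq _ (fun i => (A i + Wq i)%N) leq) lekj => //.
    exact: leq_trans.
  by move=> i; apply: leq_trans (served_in_order q i); rewrite leq_addr.
by lia.
Qed.

Lemma waiting_first A S Wq : fifo_queue A S Wq -> Wq 0%N = 0%N.
Proof.
move=> q; apply/eqP; rewrite -leqn0 leqNgt; apply/negP => W0.
by have [] := waiting_served_by_earlier q W0.
Qed.

(** Lindley's recursion.  Service in order bounds the wait from below by the time
    until customer [k] leaves; a positive wait ends no later than some earlier
    departure, hence no later than that of [k].  The subtraction is truncated:
    the value is 0 when the server is free at the arrival of [k.+1]. *)
Lemma Lindley A S Wq k : fifo_queue A S Wq ->
  Wq k.+1 = (departure A S Wq k - A k.+1)%N.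
Proof.
move=> q; have := served_in_order q k; rewrite -/(departure _ _ _ _) => leD.
have [W0|W0] := posnP (Wq k.+1); first by lia.
have [j ltjk leDj] := waiting_served_by_earlier q W0.
have := departures_nondecreasing q (ltjk : (j <= k)%N); lia.
Qed.

(** The work still owed to customers [0..k] is cleared without interruption, so
    it equals the time until the last of them leaves.  By induction: by
    [Lindley], customer [k.+1] starts either when [k] leaves, which adds
    its service time to the backlog, or later, when the earlier work is over. *)
Lemma sum_residual_work A S Wq k t : fifo_queue A S Wq -> (A k <= t)%N ->
  (\sum_(j < k.+1) minn (S j) (departure A S Wq j - t) =
   departure A S Wq k - t)%N.
Proof.
move=> q; elim: k => [|k IHk] leAt.
  rewrite big_ord_recr big_ord0 /= /departure (waiting_first q); lia.
have leA := arrivals_ordered q k.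
rewrite big_ord_recr /= IHk; last by lia.
have := Lindley k q; rewrite /departure; lia.
Qed.

(** Customers [n], [n.+1], ... have not arrived before [t], so the series
    defining the workload is eventually constant. *)
Lemma workloadE (R : realType) A S Wq n t : fifo_queue A S Wq -> (t <= A n)%N ->
  workload R A S Wq t = (\sum_(k < n) remaining_work_nat A S Wq k t)%:R.
Proof.
move=> q letA; apply/cvg_lim; first exact: Rhausdorff.
apply: (@cvg_near_cst _ _ _ _ _ eventually_filter).
exists n => // m /= lenm.
rewrite seriesEnat /= (@big_cat_nat _ _ _ n) //= big_mkord.
rewrite [X in _ + X]big1_seq => [|i]; last first.
  rewrite mem_index_iota => /andP[_ /andP[leni _]].
  rewrite remaining_workE /remaining_work_nat ltnNge.
  by rewrite (leq_trans letA (arrivals_nondecreasing q leni)).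
by rewrite addr0 natr_sum; apply: eq_bigr => i _; rewrite remaining_workE.
Qed.

(** A customer of the same batch has not begun its service at the arrival of
    [k], hence its term S is also its term in [sum_residual_work]; together the
    strictly earlier arrivals and the batch form the backlog of [0..k-1]. *)
Lemma workload_at_arrivalE (R : realType) A S Wq k : fifo_queue A S Wq ->
  workload_at_arrival R A S Wq k = (Wq k)%:R.
Proof.
move=> q; rewrite /workload_at_arrival (workloadE _ (n := k)) //.
rewrite -natr_sum -natrD (big_mkcond (fun j : 'I_k => A j == A k)) -big_split.
congr _%:R; transitivity (\sum_(j < k) minn (S j) (departure A S Wq j - A k))%N.
  apply: eq_bigr => i _; rewrite /remaining_work_nat /departure eqn_leq.
  have -> /= := arrivals_nondecreasing q (ltnW (ltn_ord i)).
  by case: ltnP => leA; [rewrite addn0 | rewrite add0n (minn_idPl _) //; lia].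
case: k => [|k]; first by rewrite big_ord0 (waiting_first q).
rewrite (Lindley _ q) sum_residual_work //; exact: arrivals_ordered q _.
Qed.

(** * Contribution of one customer to the accumulated workload *)

(** The binomial coefficient is (S - 1) + (S - 2) + ... + 0, accumulated during
    service, while S * Wq is accumulated during the wait. *)
Definition total_work (S Wq : nat -> nat) (k : nat) : nat :=
  (S k * Wq k + 'C(S k, 2))%N.

Lemma sum_remaining_work A S Wq k T : (departure A S Wq k <= T)%N ->
  (\sum_(1 <= t < T.+1) remaining_work_nat A S Wq k t = total_work S Wq k)%N.
Proof.
rewrite /total_work /departure => leDT.
(* Cut time at the arrival, the start of service and the departure. *)
rewrite (@big_cat_nat _ _ _ (A k).+1) /=; [|lia..].
rewrite big_nat big1 ?add0n => [|t ht]; last first.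
  by rewrite /remaining_work_nat; case: ifP; lia.
rewrite (@big_cat_nat _ _ _ (A k + Wq k).+1) /=; [|lia..].
rewrite (@big_cat_nat _ _ _ (A k + Wq k + S k).+1 (A k + Wq k).+1) /=; [|lia..].
rewrite [X in (_ + (_ + X))%N]big_nat [X in (_ + (_ + X))%N]big1 ?addn0
  => [|t ht]; last first.
  by rewrite /remaining_work_nat /departure; case: ifP; lia.
congr addn.
  rewrite (eq_big_nat _ _ (F2 := fun=> S k)) => [|t]; last first.
    by rewrite /remaining_work_nat /departure => ?; case: ifP; lia.
  by rewrite sum_nat_const_nat; lia.
rewrite -[X in \sum_(X <= i < _) _]add0n.
rewrite (_ : (A k + Wq k + S k).+1 = (S k + (A k + Wq k).+1)%N); last by lia.
rewrite big_addn addnK.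
(* The work left decreases, so the triangular sum is read backwards. *)
rewrite -triangular_sum big_nat_rev /=; apply: eq_big_nat => i hi.
by rewrite /remaining_work_nat /departure; case: ifP; lia.
Qed.

Lemma sum_remaining_work_le A S Wq k T :
  (\sum_(1 <= t < T.+1) remaining_work_nat A S Wq k t <= total_work S Wq k)%N.
Proof.
rewrite -(@sum_remaining_work A S Wq k (T + departure A S Wq k)) ?leq_addl //.
by rewrite [leqRHS](@big_cat_nat _ _ _ T.+1) /= ?leq_addr //; lia.
Qed.

(** * Counting arrivals *)

Definition arrivals_by (A : nat -> nat) (t : nat) : nat :=
  (#|` fset_set [set k | (A k <= t)%N]|)%fset.

(** Since arrivals are ordered, the customers arrived by [t] form an initial
    segment of the naturals, whose length is their number. *)
Lemma ltn_arrivals_by A S Wq k t : fifo_queue A S Wq ->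
  (k < arrivals_by A t)%N = (A k <= t)%N.
Proof.
move=> q.
have ex : exists n, (t < A n)%N.
  have /cvgnyPge /(_ t.+1) [n _ hn] := arrivals_diverge q.
  by exists n; exact: hn (leqnn n).
pose n := ex_minn ex.
have ltn_n i : (i < n)%N = (A i <= t)%N.
  rewrite /n; case: ex_minnP => m ltm minm; apply/idP/idP.
    by rewrite ltnNge => /negP Nmi; rewrite leqNgt; apply/negP => /minm.
  rewrite ltnNge => leAi; apply/negP => /(arrivals_nondecreasing q) leAmi.
  by have := leq_trans ltm (leq_trans leAmi leAi); rewrite ltnn.
rewrite /arrivals_by (_ : [set i | _] = `I_n); last first.
  by apply/seteqP; split=> i /=; rewrite ltn_n.
by rewrite (card_fset_set (card_eqxx _)) ltn_n.
Qed.

Lemma cvg_arrivals_by A S Wq : fifo_queue A S Wq ->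
  arrivals_by A t @[t --> \oo] --> \oo.
Proof.
move=> q; apply/cvgnyPge => -[|k]; first exact: nearW.
by exists (A k) => // t /= leAt; rewrite (ltn_arrivals_by _ _ q).
Qed.

(** * Asymptotics of ratios u n / n *)

Section asymptotic_ratios.
Context {R : realType}.
Implicit Types (u : nat -> R) (p x : nat -> nat) (l m : R).

(** Change of time scale, by u (p n) / n = (u (p n) / p n) * (p n / n).  It turns
    averages over customers into averages over time, with [p] the arrival
    count, and absorbs shifts of time of order o(n). *)
Lemma cvg_ratio_comp u p l m : u n / n%:R @[n --> \oo] --> l ->
  p n @[n --> \oo] --> \oo -> (p n)%:R / n%:R @[n --> \oo] --> m ->
  u (p n) / n%:R @[n --> \oo] --> l * m.
Proof.
move=> ul poo pm.
have up := cvg_comp _ _ poo ul.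
apply: cvg_trans (cvgM up pm); apply: near_eq_cvg.
have /cvgnyPge /(_ 1%N) := poo.
apply: filterS => n p_gt0 /=.
by rewrite mulrA mulfVK // pnatr_eq0 -lt0n.
Qed.

Lemma cvg_natV : (n%:R^-1 : R) @[n --> \oo] --> 0.
Proof. by rewrite -cvg_shiftS; exact: cvg_harmonic. Qed.

Lemma cvg_ratio_succ : (n.+1%:R / n%:R : R) @[n --> \oo] --> (1 : R).
Proof.
rewrite -[X in _ --> X]addr0.
apply: cvg_trans (cvgD (cvg_cst (1 : R)) cvg_natV).
apply: near_eq_cvg; exists 1%N => // n /= n_gt0.
by rewrite -natr1 mulrDl mul1r divff // pnatr_eq0 -lt0n.
Qed.

Lemma arithmetic_meanP u l : arithmetic_mean u @ \oo --> l <->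
  (\sum_(k < n) u k) / n%:R @[n --> \oo] --> l.
Proof.
rewrite -(cvg_shiftS (fun n => (\sum_(k < n) u k) / n%:R)).
suff -> : arithmetic_mean u = [sequence (\sum_(k < n.+1) u k) / n.+1%:R]_n by [].
by apply/funext => n; rewrite /arithmetic_mean /= seriesEord mulrC.
Qed.

(** The term of rank [n] is the difference of two consecutive partial sums, both
    of which are l n + o(n). *)
Lemma cvg_mean_term u l : (\sum_(k < n) u k) / n%:R @[n --> \oo] --> l ->
  u n / n%:R @[n --> \oo] --> 0.
Proof.
move=> ul; have : n.+1 @[n --> \oo] --> \oo.
  by apply/cvgnyPge => a; exists a => // n /= /leqW.
move=> /(cvg_ratio_comp ul) /(_ cvg_ratio_succ) /cvgB /(_ ul).
rewrite mulr1 subrr => diff0.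
apply: cvg_trans diff0; apply: near_eq_cvg; near=> n.
by rewrite /= !fctE big_ord_recr /= mulrDl addrAC subrr add0r.
Unshelve. all: by end_near.
Qed.

(** The running maximum of an o(n) sequence is o(n): the terms beyond some rank
    are at most (e / 2) k <= (e / 2) n, and the maximum [C] of the others is
    fixed. *)
Lemma cvg_ratio_max x : (x n)%:R / n%:R @[n --> \oo] --> (0 : R) ->
  (\max_(k < n) x k)%:R / n%:R @[n --> \oo] --> (0 : R).
Proof.
move=> x0; apply/cvgrPdist_le => e e0.
have e20 : 0 < e / 2 by rewrite divr_gt0.
have /cvgrPdist_le /(_ _ e20) [n0 _ small] := x0.
pose C := (\max_(k < n0.+1) x k)%N.
have bound k n : (k < n)%N -> (x k)%:R <= C%:R + e / 2 * n%:R.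
  move=> ltkn; have [lekn0|ltn0k] := leqP k n0.
    apply: (@le_trans _ _ C%:R).
      by rewrite ler_nat (leq_bigmax (Ordinal (lekn0 : (k < n0.+1)%N))).
    by rewrite lerDl mulr_ge0 // ltW.
  have := small k (ltnW ltn0k); rewrite sub0r normrN ger0_norm //.
  rewrite ler_pdivrMr ?ltr0n; last by lia.
  move=> /le_trans; apply; rewrite -[leLHS]add0r lerD //.
  by rewrite ler_pM2l // ler_nat ltnW.
have : C%:R / n%:R @[n --> \oo] --> (0 : R).
  by rewrite -(mulr0 C%:R); exact: cvgM (cvg_cst _) cvg_natV.
move=> /cvgrPdist_le /(_ _ e20); apply: filterS2 (nbhs_infty_gt 0) => n n0' /=.
rewrite !sub0r !normrN !ger0_norm // !ler_pdivrMr ?ltr0n // => leC.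
have : (\max_(k < n) x k)%:R <= C%:R + e / 2 * n%:R.
  elim/big_ind : _ => [|a b ha hb|k _]; last exact: bound.
    by rewrite addr_ge0 // mulr_ge0 // ltW.
  by rewrite /maxn; case: ifP.
lra.
Qed.

End asymptotic_ratios.

(** * The time average of the workload *)

Definition max_sojourn (A S Wq : nat -> nat) (t : nat) : nat :=
  \max_(k < arrivals_by A t) (Wq k + S k).

Lemma sum_workload (R : realType) A S Wq T : fifo_queue A S Wq ->
  \sum_(j < T) workload R A S Wq j.+1 =
  (\sum_(k < arrivals_by A T)
    \sum_(1 <= t < T.+1) remaining_work_nat A S Wq k t)%:R.
Proof.
move=> q; rewrite exchange_big /= big_add1 /= big_mkord natr_sum.
apply: eq_bigr => j _; rewrite (workloadE _ (n := arrivals_by A T)) //.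
(* The customer numbered by the count of arrivals is the first not yet here. *)
have : (arrivals_by A T < arrivals_by A T)%N = false by rewrite ltnn.
rewrite (ltn_arrivals_by _ _ q) => /negbT; rewrite -ltnNge => ltT.
exact: leq_trans (ltn_ord j) (ltnW ltT).
Qed.

Lemma sum_workload_le (R : realType) A S Wq T : fifo_queue A S Wq ->
  \sum_(j < T) workload R A S Wq j.+1 <=
  (\sum_(k < arrivals_by A T) total_work S Wq k)%:R.
Proof.
move=> q; rewrite sum_workload // ler_nat.
by apply: leq_sum => k _; exact: sum_remaining_work_le.
Qed.

(** Whoever arrived by T - c has left by T when c bounds the sojourns, so its
    whole contribution falls before T. *)
Lemma sum_workload_ge (R : realType) A S Wq T : fifo_queue A S Wq ->
  (max_sojourn A S Wq T <= T)%N ->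
  (\sum_(k < arrivals_by A (T - max_sojourn A S Wq T)) total_work S Wq k)%:R <=
  \sum_(j < T) workload R A S Wq j.+1.
Proof.
move=> q; set c := max_sojourn A S Wq T => lecT; rewrite sum_workload // ler_nat.
have leN : (arrivals_by A (T - c) <= arrivals_by A T)%N.
  rewrite leqNgt; apply/negP => ltN.
  have := ltN; rewrite (ltn_arrivals_by _ _ q) => leA.
  have := ltn_arrivals_by (arrivals_by A T) T q; rewrite ltnn.
  by rewrite (leq_trans leA (leq_subr _ _)).
rewrite (big_ord_widen _ (total_work S Wq) leN) big_mkcond /=.
apply: leq_sum => k _; case: ifP => //; rewrite (ltn_arrivals_by _ _ q) => leA.
have : (Wq k + S k <= c)%N.
  exact: (leq_bigmax (F := fun k : 'I__ => (Wq k + S k)%N) k).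
by move=> leWSc; rewrite sum_remaining_work // /departure; lia.
Qed.

(** The instance of H = lambda G for the workload.  The hypothesis with limit
    [sigma] is there to make sojourn times o(n). *)
Lemma cvg_time_average_workload (R : realType) A S Wq (lambda phi sigma : R) :
  fifo_queue A S Wq ->
  arrival_frequency R A t @[t --> \oo] --> lambda ->
  (\sum_(k < n) (total_work S Wq k)%:R) / n%:R @[n --> \oo] --> phi ->
  (\sum_(k < n) (Wq k + S k)%:R) / n%:R @[n --> \oo] --> sigma ->
  (\sum_(j < t) workload R A S Wq j.+1) / t%:R @[t --> \oo] --> phi * lambda.
Proof.
move=> q hlam hphi hsig.
have Noo := cvg_arrivals_by q.
pose c := max_sojourn A S Wq.
have c0 : (c t)%:R / t%:R @[t --> \oo] --> (0 : R).
  rewrite -(mul0r lambda).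
  have max0 := cvg_ratio_max (x := fun k => (Wq k + S k)%N) (cvg_mean_term hsig).
  exact: cvg_ratio_comp max0 Noo hlam.
(* Any factor below 1 would do: it makes both c <= t and t - c unbounded. *)
have lec : \forall t \near \oo, (c t)%:R <= 2^-1 * t%:R :> R.
  have /cvgrPdist_le /(_ 2^-1) := c0; rewrite invr_gt0 ltr0n => /(_ isT).
  apply: filterS2 (nbhs_infty_gt 0) => t t_gt0.
  by rewrite sub0r normrN ger0_norm // ler_pdivrMr ?ltr0n.
have lecn : \forall t \near \oo, (c t <= t)%N.
  apply: filterS lec => t let2; rewrite -(ler_nat R); apply: le_trans let2 _.
  by have := ler0n R t; lra.
have p1 : (t - c t)%:R / t%:R @[t --> \oo] --> (1 : R).
  rewrite -[X in _ --> X]subr0; apply: cvg_trans (cvgB (cvg_cst (1 : R)) c0).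
  apply: near_eq_cvg; apply: filterS2 lecn (nbhs_infty_gt 0) => t lect t_gt0.
  by rewrite !fctE natrB // mulrBl divff // pnatr_eq0 -lt0n.
have poo : (t - c t)%N @[t --> \oo] --> \oo.
  apply/cvgnyPge => a.
  apply: filterS3 lec lecn (nbhs_infty_ge (2 * a)) => t let2 lect leat.
  rewrite -(ler_nat R) natrB //.
  have : (2 * a)%:R <= t%:R :> R by rewrite ler_nat.
  by rewrite natrM; lra.
have Npoo : arrivals_by A (t - c t) @[t --> \oo] --> \oo := cvg_comp _ _ poo Noo.
have Np : (arrivals_by A (t - c t))%:R / t%:R @[t --> \oo] --> lambda.
  rewrite -(mulr1 lambda).
  exact: (cvg_ratio_comp (u := fun t => (arrivals_by A t)%:R) hlam poo p1).
apply: squeeze_cvgr (cvg_ratio_comp hphi Npoo Np) (cvg_ratio_comp hphi Noo hlam).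
apply: filterS2 lecn (nbhs_infty_gt 0) => t lect t_gt0.
rewrite !ler_pM2r ?invr_gt0 ?ltr0n // -!natr_sum.
by rewrite sum_workload_ge // sum_workload_le.
Qed.

Unset Implicit Arguments.
Set Strict Implicit.

(** * The mean waiting time *)

Theorem corollary7p3 (R : realType) (A S Wq : nat -> nat)
    (lambda ES ES2 EWq ESWq rho : R)
    (hqueue : fifo_queue A S Wq)
    (hlambda : arrival_frequency R A t @[t --> \oo] --> lambda)
    (hES : arithmetic_mean (fun k => (S k)%:R : R) @ \oo --> ES)
    (hES2 : arithmetic_mean (fun k => (S k)%:R ^+ 2 : R) @ \oo --> ES2)
    (hEWq : arithmetic_mean (fun k => (Wq k)%:R : R) @ \oo --> EWq)
    (hESWq : arithmetic_mean (fun k => (S k)%:R * (Wq k)%:R : R) @ \oo --> ESWq)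
    (hindep : ESWq = ES * EWq)
    (hASTA : workload_ASTA R A S Wq)
    (hrho : rho = lambda * ES)
    (hstable : rho < 1) :
  EWq = lambda * (ES2 - ES) / (2 * (1 - rho)).
Proof.
have hmean (u : nat -> R) l := (@arithmetic_meanP R u l).1.
have hphi : (\sum_(k < n) (total_work S Wq k)%:R) / n%:R @[n --> \oo] -->
    (ESWq + (ES2 - ES) / 2 : R).
  apply: cvg_trans (cvgD (hmean _ _ hESWq)
    (cvgM (cvgB (hmean _ _ hES2) (hmean _ _ hES)) (cvg_cst (2^-1 : R)))).
  apply: near_eq_cvg; apply: nearW => n.
  rewrite !fctE /= -mulrBl mulrAC -mulrDl; congr (_ / _).
  rewrite -sumrB mulr_suml -big_split; apply: eq_bigr => k _ /=.
  rewrite /total_work natrD natrM; congr (_ + _).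
  have : ('C(S k, 2) * 2)%:R = (S k)%:R ^+ 2 - (S k)%:R :> R.
    rewrite (mulnC 'C(_, 2)) -(mul_bin_diag _ 1) bin1.
    have := service_ge1 hqueue k; case: (S k) => // s _.
    by rewrite natrM -natr1; ring.
  by rewrite natrM; lra.
have hsig : (\sum_(k < n) (Wq k + S k)%:R) / n%:R @[n --> \oo] --> (EWq + ES : R).
  apply: cvg_trans (cvgD (hmean _ _ hEWq) (hmean _ _ hES)).
  apply: near_eq_cvg; apply: nearW => n.
  rewrite !fctE /= -mulrDl -big_split; congr (_ / _).
  by apply: eq_bigr => k _; rewrite natrD.
have EV : time_average_workload R A S Wq = (ESWq + (ES2 - ES) / 2) * lambda.
  apply/cvg_lim; first exact: Rhausdorff.
  apply/arithmetic_meanP; exact: cvg_time_average_workload hphi hsig.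
have EVA : customer_average_workload R A S Wq = EWq.
  apply/cvg_lim; first exact: Rhausdorff.
  rewrite (_ : workload_at_arrival R A S Wq = fun k => (Wq k)%:R) //.
  by apply/funext => k; exact: workload_at_arrivalE.
move: hASTA; rewrite /workload_ASTA EV EVA hindep => eqW.
apply: (canRL (mulfK _)); first by rewrite mulf_neq0 // subr_eq0 gt_eqF.
rewrite hrho mulrBr mulr1 [LHS]mulrBr.
by rewrite {1}eqW; field.
Qed.
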